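(* Let $f,h_1,\dots,h_s:\mathbb{R}^n\to\mathbb{R}$ be convex and twice differentiable, let $g_1,\dots,g_r:\mathbb{R}^n\to\mathbb{R}$ be affine, and for $\rho\ge 0$ let $$\mathcal{E}_\rho(y)=f(y)+\rho\sum_{i=1}^r|g_i(y)|+\rho\sum_{j=1}^s\max\{0,h_j(y)\}.$$ Suppose that $\mathcal{E}_\rho$ is strictly convex and coercive (for $\rho>0$; each of these two properties holds for one $\rho>0$ if and only if it holds for all $\rho>0$), and let $x(\rho)$ denote its minimizer. Let $\rho_0>0$, and define index sets from the signs of the constraint functions at $x(\rho_0)$: $$\mathcal{N}_E=\{i:g_i<0\},\quad \mathcal{Z}_E=\{i:g_i=0\},\quad \mathcal{P}_E=\{i:g_i>0\},$$ $$\mathcal{N}_I=\{j:h_j<0\},\quad \mathcal{Z}_I=\{j:h_j=0\},\quad \mathcal{P}_I=\{j:h_j>0\}.$$ With these index sets fixed, let $$M(x,\omega,\rho)=\begin{pmatrix} d^2f(x)+\rho\sum_{j\in\mathcal{P}_I}d^2h_j(x)+\sum_{j\in\mathcal{Z}_I}\omega_j\,d^2h_j(x) & U_{\mathcal{Z}}(x)^t\\ U_{\mathcal{Z}}(x) & \mathbf{0}\end{pmatrix},$$ where $U_{\mathcal{Z}}(x)$ is the matrix with rows $dg_i(x)$, $i\in\mathcal{Z}_E$, followed by $dh_j(x)$, $j\in\mathcal{Z}_I$, and let $$u_{\bar{\mathcal{Z}}}(x)=-\sum_{i\in\mathcal{N}_E}\nabla g_i(x)+\sum_{i\in\mathcal{P}_E}\nabla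 g_i(x)+\sum_{j\in\mathcal{P}_I}\nabla h_j(x).$$ If at the point $x(\rho_0)$ (with $\rho=\rho_0$ and the corresponding multipliers $\omega=\omega(\rho_0)$) the matrix $M$ is nonsingular, and the coefficient of each active constraint lies in the interior of its subdifferential, that is, $-1<s_i(\rho_0)<1$ for $i\in\mathcal{Z}_E$ and $0<t_j(\rho_0)<1$ for $j\in\mathcal{Z}_I$, then in the vicinity of $x(\rho_0)$ (that is, for $\rho$ near $\rho_0$) the solution path $x(\rho)$ and the Lagrange multipliers $\lambda(\rho)=(\lambda_i(\rho))_{i\in\mathcal{Z}_E}$ and $\omega(\rho)=(\omega_j(\rho))_{j\in\mathcal{Z}_I}$ satisfy the differential equation $$\frac{d}{d\rho}\begin{pmatrix}x\\ \lambda\\ \omega\end{pmatrix}=-M(x,\omega,\rho)^{-1}\begin{pmatrix}u_{\bar{\mathcal{Z}}}(x)\\ \mathbf{0}\end{pmatrix}.$$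
   Context: The setting is the convex program of minimizing $f(x)$ subject to the affine equality constraints $g_i(x)=0$ and the convex inequality constraints $h_j(x)\le 0$; $\mathcal{E}_\rho$ is its exact penalty surrogate. A function is coercive if it tends to $+\infty$ as $\|y\|\to\infty$. Here $d$ denotes the differential (row vector of partial derivatives), $\nabla$ its transpose, and $d^2$ the Hessian matrix. A constraint is active at $x$ if $g_i(x)=0$, respectively $h_j(x)=0$. The coefficients $s_i(\rho),t_j(\rho)$ are real numbers for which, with $x=x(\rho)$, $$\mathbf{0}=\nabla f(x)+\rho\sum_{i=1}^r s_i(\rho)\nabla g_i(x)+\rho\sum_{j=1}^s t_j(\rho)\nabla h_j(x),$$ subject to $s_i(\rho)=-1$ if $g_i(x)<0$, $s_i(\rho)\in[-1,1]$ if $g_i(x)=0$, $s_i(\rho)=1$ if $g_i(x)>0$, and $t_j(\rho)=0$ if $h_j(x)<0$, $t_j(\rho)\in[0,1]$ if $h_j(x)=0$, $t_j(\rho)=1$ if $h_j(x)>0$. The Lagrange multipliers are $\lambda_i(\rho)=\rho s_i(\rho)$ for $i\in\mathcal{Z}_E$ and $\omega_j(\rho)=\rho t_j(\rho)$ for $j\in\mathcal{Z}_I$.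
   Formalization: Beyond twice differentiability, the Hessians of f and of those h_j with h_j(x(ρ0)) ≥ 0 are assumed continuous at the point x(ρ0); with mere twice differentiability the path can fail to be differentiable at ρ arbitrarily near ρ0. *)

(* Defs.v *)
From HB Require Import structures.
From mathcomp Require Import all_boot all_order all_algebra.
From mathcomp Require Import all_classical all_reals all_analysis.

Set Implicit Arguments.
Unset Strict Implicit.
Unset Printing Implicit Defensive.

Import Order.TTheory GRing.Theory Num.Theory.
Import numFieldNormedType.Exports.

Local Open Scope classical_set_scope.
Local Open Scope ring_scope.

Section Functions.
Variables (R : realType) (n : nat).
Implicit Types (f : 'cV[R]_n -> R) (x y : 'cV[R]_n).

Definition affine_function f : Prop :=
  exists (a : 'rV[R]_n) (b : R), forall y, f y = (a *m y) 0 0 + b.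

Definition strictly_convex f : Prop :=
  forall x y (t : R), x != y -> 0 < t -> t < 1 ->
    f (t *: x + (1 - t) *: y) < t * f x + (1 - t) * f y.

(* The norm on 'cV[R]_n is the max norm; all norms on R^n give the same
   coercive functions. *)
Definition coercive f : Prop :=
  forall A : R, exists B : R, forall y, B <= `|y| -> A <= f y.

(* The differential d f(x), as the row vector of partial derivatives. *)
Definition dif f x : 'rV[R]_n := \row_j 'D_(delta_mx j 0) (f : _ -> R^o) x.

Definition grad f x : 'cV[R]_n := (dif f x)^T.

Definition hess f x : 'M[R]_n :=
  \matrix_(i, j) 'D_(delta_mx j 0) (fun y => dif f y 0 i : R^o) x.

(* Frechet differentiability everywhere, of f and then of its differential. *)
Definition twice_differentiable f : Prop :=
  (forall x, differentiable (f : _ -> R^o) x) /\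
  (forall x, differentiable (dif f) x).

End Functions.

(* c is an admissible coefficient at the value u: it lies in the
   subdifferential of |.| at u. *)
Definition abs_coef (R : realType) (u c : R) : Prop :=
  [/\ u < 0 -> c = -1, u = 0 -> -1 <= c <= 1 & 0 < u -> c = 1].

(* Same for the subdifferential of max {0, .} at u. *)
Definition pos_coef (R : realType) (u c : R) : Prop :=
  [/\ u < 0 -> c = 0, u = 0 -> 0 <= c <= 1 & 0 < u -> c = 1].

Section Program.
Variables (R : realType) (n r s : nat).
Variables (f : 'cV[R]_n -> R).
Variables (g : 'I_r -> 'cV[R]_n -> R) (h : 'I_s -> 'cV[R]_n -> R).

Definition surrogate (rho : R) (y : 'cV[R]_n) : R :=
  f y + rho * \sum_i `|g i y| + rho * \sum_j Num.max 0 (h j y).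

Definition minimizes (F : 'cV[R]_n -> R) (x : 'cV[R]_n) : Prop :=
  forall y, F x <= F y.

Definition stationary_coefs (rho : R) (x : 'cV[R]_n)
    (sc : 'I_r -> R) (tc : 'I_s -> R) : Prop :=
  [/\ grad f x + rho *: (\sum_i sc i *: grad (g i) x)
        + rho *: (\sum_j tc j *: grad (h j) x) = 0,
      forall i, abs_coef (g i x) (sc i)
    & forall j, pos_coef (h j x) (tc j)].

(* The index sets are read off at a reference point x0 and stay fixed while
   the point at which the matrices are evaluated moves. *)
Variable x0 : 'cV[R]_n.

Definition eq_neg : {set 'I_r} := [set i | g i x0 < 0].
Definition eq_zero : {set 'I_r} := [set i | g i x0 == 0].
Definition eq_pos : {set 'I_r} := [set i | 0 < g i x0].
Definition ineq_zero : {set 'I_s} := [set j | h j x0 == 0].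
Definition ineq_pos : {set 'I_s} := [set j | 0 < h j x0].

(* Families over eq_zero and ineq_zero are vectors, the k-th entry being the one
   attached to the k-th element (enum_val k) of the set. *)
Definition eq_mult (rho : R) (sc : 'I_r -> R) : 'cV[R]_#|eq_zero| :=
  \col_k (rho * sc (enum_val k)).
Definition ineq_mult (rho : R) (tc : 'I_s -> R) : 'cV[R]_#|ineq_zero| :=
  \col_k (rho * tc (enum_val k)).

Definition active_jacobian (x : 'cV[R]_n) : 'M[R]_(#|eq_zero| + #|ineq_zero|, n) :=
  col_mx (\matrix_(k < #|eq_zero|) dif (g (enum_val k)) x)
         (\matrix_(k < #|ineq_zero|) dif (h (enum_val k)) x).

Definition inactive_grad (x : 'cV[R]_n) : 'cV[R]_n :=
  - (\sum_(i in eq_neg) grad (g i) x) + \sum_(i in eq_pos) grad (g i) x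
    + \sum_(j in ineq_pos) grad (h j) x.

Definition kkt_matrix (x : 'cV[R]_n) (omega : 'cV[R]_#|ineq_zero|) (rho : R)
    : 'M[R]_(n + (#|eq_zero| + #|ineq_zero|)) :=
  block_mx
    (hess f x + rho *: (\sum_(j in ineq_pos) hess (h j) x)
      + \sum_(k < #|ineq_zero|) omega k 0 *: hess (h (enum_val k)) x)
    (active_jacobian x)^T
    (active_jacobian x)
    0.

End Program.

Arguments kkt_matrix [R n r s] f g h x0 x omega rho.

(* Main.v *)
Require Import Defs.
From mathcomp Require Import all_boot all_order all_algebra.
From mathcomp Require Import all_classical all_reals all_analysis.
From mathcomp Require Import lra.

(* Along the path, stationarity reads grad f + rho u + U^T (lambda, omega) = 0,
   where the inactive coefficients are frozen because x(rho) is continuous.  As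
   M is nonsingular, U has full row rank, so this linear equation determines the
   multipliers continuously in x and rho.  At rho0 they lie strictly inside
   their subdifferentials, hence still do so for rho near rho0, and this forces
   the active constraints to stay active.  The path thus solves the square KKT
   system on a neighbourhood of rho0, so no implicit function theorem is needed:
   with Caratheodory slopes, the increment (dx, dlambda, domega) solves exactly a
   linear system whose matrix tends to M and whose right-hand side is
   - drho (u, 0). *)

Import Order.TTheory GRing.Theory Num.Theory.
Import numFieldNormedType.Exports.

Local Open Scope classical_set_scope.
Local Open Scope ring_scope.

Set Implicit Arguments.
Unset Strict Implicit.

(** * Limits of matrices, of inverses and of solutions of linear systems *)

Lemma cvg_mx (T : Type) (F : set_system T) {FF : Filter F} (K : numFieldType)
    (m n : nat) (A : T -> 'M[K]_(m, n)) (A0 : 'M[K]_(m, n)) :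
  (forall i j, A t i j @[t --> F] --> A0 i j) -> A @ F --> A0.
Proof.
move=> Aij X [P A0P PX].
suff : \forall t \near F, forall i j, P i j (A t i j).
  by apply: filterS => t Pt; apply: PX.
by apply: filter_forall => i; apply: filter_forall => j; exact: Aij (A0P i j).
Qed.

Lemma cvg_mx_coord (T : Type) (F : set_system T) {FF : Filter F}
    (K : numFieldType) (m n : nat) (A : T -> 'M[K]_(m, n)) (A0 : 'M[K]_(m, n))
    (i : 'I_m) (j : 'I_n) :
  A @ F --> A0 -> A t i j @[t --> F] --> A0 i j.
Proof.
by move=> AF; exact: (continuous_cvg _ (@coord_continuous K m n i j A0) AF).
Qed.

Section MatrixLimits.
Context (T : Type) (F : set_system T) {FF : Filter F} (K : numFieldType).

Lemma cvg_sum (V : normedModType K) (I : Type) (r : seq I) (P : pred I)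
    (f : I -> T -> V) (l : I -> V) :
  (forall i, P i -> f i t @[t --> F] --> l i) ->
  \sum_(i <- r | P i) f i t @[t --> F] --> \sum_(i <- r | P i) l i.
Proof.
by move=> fl; exact: (@cvg_big V I +%R 0 P (@add_continuous V) _ F r _ _ _ fl).
Qed.

Lemma cvg_prod (I : Type) (r : seq I) (P : pred I) (f : I -> T -> K) (l : I -> K) :
  (forall i, P i -> f i t @[t --> F] --> l i) ->
  \prod_(i <- r | P i) f i t @[t --> F] --> \prod_(i <- r | P i) l i.
Proof.
by move=> fl; exact: (@cvg_big K I *%R 1 P (@mul_continuous K) _ F r _ _ _ fl).
Qed.

Lemma cvg_mulmx (m n p : nat) (A : T -> 'M[K]_(m, n)) (B : T -> 'M[K]_(n, p))
    (A0 : 'M[K]_(m, n)) (B0 : 'M[K]_(n, p)) :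
  A @ F --> A0 -> B @ F --> B0 -> A t *m B t @[t --> F] --> A0 *m B0.
Proof.
move=> AF BF; apply: cvg_mx => i j; rewrite mxE; under eq_cvg do rewrite mxE.
by apply: cvg_sum => k _; apply: cvgM; exact: cvg_mx_coord.
Qed.

Lemma cvg_trmx (m n : nat) (A : T -> 'M[K]_(m, n))
    (A0 : 'M[K]_(m, n)) :
  A @ F --> A0 -> (A t)^T @[t --> F] --> A0^T.
Proof.
move=> AF; apply: cvg_mx => i j; rewrite mxE; under eq_cvg do rewrite mxE.
exact: cvg_mx_coord.
Qed.

Lemma cvg_col_mx (m1 m2 n : nat) (A : T -> 'M[K]_(m1, n)) (B : T -> 'M[K]_(m2, n))
    (A0 : 'M[K]_(m1, n)) (B0 : 'M[K]_(m2, n)) :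
  A @ F --> A0 -> B @ F --> B0 -> col_mx (A t) (B t) @[t --> F] --> col_mx A0 B0.
Proof.
move=> AF BF; apply: cvg_mx => i j; rewrite mxE; under eq_cvg do rewrite mxE.
by case: (fintype.split i) => k; exact: cvg_mx_coord.
Qed.

Lemma cvg_row_mx (m n1 n2 : nat) (A : T -> 'M[K]_(m, n1)) (B : T -> 'M[K]_(m, n2))
    (A0 : 'M[K]_(m, n1)) (B0 : 'M[K]_(m, n2)) :
  A @ F --> A0 -> B @ F --> B0 -> row_mx (A t) (B t) @[t --> F] --> row_mx A0 B0.
Proof.
move=> AF BF; apply: cvg_mx => i j; rewrite mxE; under eq_cvg do rewrite mxE.
by case: (fintype.split j) => k; exact: cvg_mx_coord.
Qed.

Lemma cvg_det (n : nat) (A : T -> 'M[K]_n) (A0 : 'M[K]_n) :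
  A @ F --> A0 -> \det (A t) @[t --> F] --> \det A0.
Proof.
move=> AF; apply: cvg_sum => s _; apply: cvgMr.
by apply: cvg_prod => i _; exact: cvg_mx_coord.
Qed.

Lemma near_unitmx (n : nat) (A : T -> 'M[K]_n) (A0 : 'M[K]_n) :
  A @ F --> A0 -> A0 \in unitmx -> \forall t \near F, A t \in unitmx.
Proof.
move=> AF; rewrite unitmxE unitfE => d0.
apply: filterS (cvgr_neq0 (\det A0) (cvg_det AF) d0) => t.
by rewrite unitmxE unitfE.
Qed.

(** Cramer's formula: determinant and adjugate are polynomial in the entries. [invmx] is given by
    this formula only at invertible matrices, which [A t] eventually is. *)
Lemma cvg_invmx (n : nat) (A : T -> 'M[K]_n) (A0 : 'M[K]_n) :
  A @ F --> A0 -> A0 \in unitmx -> invmx (A t) @[t --> F] --> invmx A0.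
Proof.
move=> AF A0u.
apply: (@cvg_trans _ ((\det (A t))^-1 *: \adj (A t) @[t --> F])).
  apply: near_eq_cvg.
  by apply: filterS (near_unitmx AF A0u) => t; rewrite /invmx => ->.
rewrite /invmx A0u; apply: cvgZ.
  by apply: cvgV; [move: A0u; rewrite unitmxE unitfE | exact: cvg_det].
apply: cvg_mx => i j; rewrite !mxE; under eq_cvg do rewrite !mxE.
apply: cvgMr; apply: cvg_det; apply: cvg_mx => k l.
by rewrite !mxE; under eq_cvg do rewrite !mxE; exact: cvg_mx_coord.
Qed.

(** As [C *m A t] tends to the identity, it is eventually invertible, and [y t] is recovered from
    [A t *m y t]. A left inverse of the limit suffices, so the tall matrix U^T is covered as well as
    the square KKT matrix. *)
Lemma cvg_solve (m n : nat) (A : T -> 'M[K]_(m, n)) (y : T -> 'cV[K]_n)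
    (C : 'M[K]_(n, m)) (A0 : 'M[K]_(m, n)) (b : 'cV[K]_m) :
  A @ F --> A0 -> C *m A0 = 1%:M -> A t *m y t @[t --> F] --> b ->
  y @ F --> C *m b.
Proof.
move=> AF CA0 yF.
have CAF : C *m A t @[t --> F] --> (1%:M : 'M[K]_n).
  by rewrite -CA0; apply: cvg_mulmx => //; exact: cvg_cst.
have yF' : invmx (C *m A t) *m (C *m (A t *m y t)) @[t --> F]
    --> (invmx 1%:M *m (C *m b) : 'cV[K]_n).
  apply: cvg_mulmx; first by apply: cvg_invmx => //; exact: unitmx1.
  by apply: cvg_mulmx => //; exact: cvg_cst.
rewrite invmx1 mul1mx in yF'; apply: cvg_trans yF'; apply: near_eq_cvg.
apply: filterS (near_unitmx CAF (unitmx1 _ _)) => t CAu.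
by rewrite mulmxA mulKmx.
Qed.

End MatrixLimits.

(** * Caratheodory slopes and the derivative of a path solving a KKT system *)

Section Jacobian.
Variables (R : realType) (n : nat).

(* Caratheodory's form of differentiability: it leaves no Taylor remainder, so
   that a system of equations along a path becomes an exact linear system for
   the increments. *)
Definition has_jacobian (m : nat) (F : 'cV[R]_n -> 'cV[R]_m) (x : 'cV[R]_n)
    (J : 'M[R]_(m, n)) : Prop :=
  exists2 S : 'cV[R]_n -> 'M[R]_(m, n),
    forall y, F y - F x = S y *m (y - x) & S @ x --> J.

Lemma has_jacobian_cst (m : nat) (c : 'cV[R]_m) (x : 'cV[R]_n) :
  has_jacobian (fun=> c) x 0.
Proof.
exists (fun=> 0) => [y|]; first by rewrite subrr mul0mx.
(* Here and below the filter [nbhs x] is passed explicitly: unification would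
   unfold the matrix topology and lose the Filter instance. *)
exact: (@cvg_cst _ _ _ (nbhs x)).
Qed.

Lemma has_jacobianD (m : nat) (F G : 'cV[R]_n -> 'cV[R]_m) (x : 'cV[R]_n)
    (J L : 'M[R]_(m, n)) :
  has_jacobian F x J -> has_jacobian G x L ->
  has_jacobian (fun y => F y + G y) x (J + L).
Proof.
move=> [S FS SJ] [U GU UL]; exists (fun y => S y + U y) => [y|].
  by rewrite opprD addrACA FS GU mulmxDl.
exact: (cvgD SJ UL).
Qed.

Lemma has_jacobianZ (m : nat) (a : R) (F : 'cV[R]_n -> 'cV[R]_m) (x : 'cV[R]_n)
    (J : 'M[R]_(m, n)) :
  has_jacobian F x J -> has_jacobian (fun y => a *: F y) x (a *: J).
Proof.
move=> [S FS SJ]; exists (fun y => a *: S y) => [y|].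
  by rewrite -scalerBr FS scalemxAl.
exact: (cvgZ (cvg_cst a) SJ).
Qed.

Lemma has_jacobian_sum (m : nat) (I : finType) (P : pred I)
    (F : I -> 'cV[R]_n -> 'cV[R]_m) (x : 'cV[R]_n) (J : I -> 'M[R]_(m, n)) :
  (forall i, P i -> has_jacobian (F i) x (J i)) ->
  has_jacobian (fun y => \sum_(i | P i) F i y) x (\sum_(i | P i) J i).
Proof.
move=> FJ; elim: (index_enum I) => [|i r IHr].
  rewrite big_nil; under eq_fun do rewrite big_nil.
  exact: has_jacobian_cst.
rewrite big_cons; under eq_fun do rewrite big_cons.
by case: ifPn => // Pi; apply: has_jacobianD => //; exact: FJ.
Qed.

Lemma has_jacobian_rows (m : nat) (F : 'cV[R]_n -> 'cV[R]_m) (x : 'cV[R]_n)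
    (J : 'M[R]_(m, n)) :
  (forall i, has_jacobian (fun y => (F y i 0)%:M : 'cV[R]_1) x (row i J)) ->
  has_jacobian F x J.
Proof.
move=> FJ.
(* Slopes are only known to exist for each row separately; choice turns them into the rows of one
   matrix. *)
have S i : {S : 'cV[R]_n -> 'rV[R]_n |
    (forall y, F y i 0 - F x i 0 = (S y *m (y - x)) 0 0) & S @ x --> row i J}.
  apply: cid2; have [S FS SJ] := FJ i; exists S => // y.
  by rewrite -FS !mxE !mulr1n.
exists (fun y => \matrix_i s2val (S i) y) => [y|].
  apply/colP => i; rewrite !mxE (s2valP (S i)) mxE.
  by apply: eq_bigr => k _; rewrite !mxE.
apply: (@cvg_mx _ (nbhs x)) => i j; under eq_cvg do rewrite mxE.
suff : s2val (S i) y 0 j @[y --> x] --> row i J 0 j by rewrite mxE.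
exact: cvg_mx_coord (s2valP' (S i)).
Qed.


Lemma norm_coord_le (m : nat) (v : 'M[R]_(n, m)) (i : 'I_n) (j : 'I_m) :
  `|v i j| <= `|v|.
Proof.
by rewrite [leRHS]mx_normrE; apply/bigmax_geP; right; exists (i, j).
Qed.

(** The max norm is attained at some entry, whose square is one term of the dot product. This bounds
    from below the squared Euclidean length by which slopes are divided. *)
Lemma sqr_norm_le_dotmul (v : 'cV[R]_n) : `|v| ^+ 2 <= (v^T *m v) 0 0.
Proof.
have [->|v0] := eqVneq v 0; first by rewrite normr0 expr0n mulmx0 mxE.
have [[i j] /= vE] : exists i, mx_norm v = `|v i.1 i.2|.
  by apply: mx_norm_neq0; rewrite -[mx_norm v]/`|v| normr_eq0.
rewrite [`|v|]vE ord1 -normrX ger0_norm ?sqr_ge0// mxE (bigD1 i)//= mxE -expr2.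
by rewrite lerDl sumr_ge0// => k _; rewrite mxE -expr2 sqr_ge0.
Qed.

Lemma diff_dif (f : 'cV[R]_n -> R) (x v : 'cV[R]_n) :
  differentiable (f : _ -> R^o) x -> 'd (f : _ -> R^o) x v = (dif f x *m v) 0 0.
Proof.
move=> fx; rewrite {1}(matrix_sum_delta v) linear_sum mxE.
apply: eq_bigr => i _; rewrite big_ord1 linearZ /= mxE deriveE//.
by rewrite mulrC.
Qed.

(** The Taylor remainder [r] is absorbed by a rank-one correction of the slope:
    [(r y / q y) *: (y - x)^T] applied to [y - x] returns [r y], because [q y] is the squared
    Euclidean length of [y - x]. The correction vanishes in the limit since [r y] is small compared
    with [y - x]. *)
Lemma differentiable_has_jacobian (f : 'cV[R]_n -> R) (x : 'cV[R]_n) :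
  differentiable (f : _ -> R^o) x ->
  has_jacobian (fun y => (f y)%:M : 'cV[R]_1) x (dif f x).
Proof.
move=> fx.
pose r y := f y - f x - (dif f x *m (y - x)) 0 0.
pose q (y : 'cV[R]_n) : R := ((y - x)^T *m (y - x)) 0 0.
exists (fun y => dif f x + (r y / q y) *: (y - x)^T) => [y|].
  rewrite mulmxDl -scalemxAl [_^T *m _]mx11_scalar -/(q y) [_ *m _]mx11_scalar.
  rewrite scale_scalar_mx -!raddfB -raddfD; congr _%:M => /=.
  have [->|yx] := eqVneq y x; first by rewrite /q !subrr !mulmx0 !mxE mulr0 addr0.
  rewrite divfK; first by rewrite /r [RHS]addrC subrK.
  apply: lt0r_neq0; apply: lt_le_trans (sqr_norm_le_dotmul _).
  by rewrite exprn_gt0// normr_gt0 subr_eq0.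
suff rq : (r y / q y) *: (y - x)^T @[y --> x] --> (0 : 'rV[R]_n).
  rewrite -[in nbhs (dif f x)](addr0 (dif f x)).
  exact: (cvgD (@cvg_cst _ (dif f x) _ (nbhs x) _) rq).
apply: (@cvg_mx _ (nbhs x)) => i j; rewrite mxE; under eq_cvg do rewrite !mxE.
have yx0 : y - x @[y --> x] --> (0 : 'cV[R]_n).
  by rewrite -(subrr x); exact: (cvgB (@cvg_id _ (nbhs x)) (cvg_cst x)).
apply/cvgr0Pnorm_le => e e0.
have /eqaddoP /(_ e e0) /yx0 := diff_locally fx.
apply: (@filterS _ (nbhs x)) => y.
move=> oy; have rle : `|r y| <= e * `|y - x|.
  suff -> : r y = (f \o shift x - (cst (f x) + 'd (f : _ -> R^o) x)) (y - x).
    by [].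
  by rewrite /r -diff_dif // !fctE /= subrK opprD addrA.
have [->|yx] := eqVneq y x; first by rewrite subrr mulr0 normr0 ltW.
have v0 : 0 < `|y - x| by rewrite normr_gt0 subr_eq0.
have q0 : 0 < q y.
  by apply: lt_le_trans (sqr_norm_le_dotmul _); rewrite exprn_gt0.
rewrite !normrM normfV (gtr0_norm q0) mulrAC ler_pdivrMr//.
have vle : `|y j i - x j i| <= `|y - x|.
  by rewrite (le_trans _ (norm_coord_le _ j i))// !mxE.
apply: (@le_trans _ _ (e * `|y - x| * `|y - x|)); first exact: ler_pM.
by rewrite -mulrA ler_pM2l// -expr2 sqr_norm_le_dotmul.
Qed.

End Jacobian.

(** [Q] stands for the Lagrangian gradient with multipliers and penalty frozen at [rho]; their
    increments enter separately, against [U] and [u] at the moved point [x t]. The difference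
    quotient then solves a linear system exactly, and [cvg_solve] yields both the existence and the
    value of its limit. *)
Lemma kkt_path_is_derive (R : realType) (n p : nat) (Q u : 'cV[R]_n -> 'cV[R]_n)
    (c : 'cV[R]_n -> 'cV[R]_p) (U : 'cV[R]_n -> 'M[R]_(p, n)) (H : 'M[R]_n)
    (x : R -> 'cV[R]_n) (w : R -> 'cV[R]_p) (rho : R)
    (M := block_mx H (U (x rho))^T (U (x rho)) 0) :
  has_jacobian Q (x rho) H -> has_jacobian c (x rho) (U (x rho)) ->
  {for x rho, continuous U} -> {for x rho, continuous u} ->
  {for rho, continuous x} -> M \in unitmx ->
  (\forall t \near rho, [/\ Q (x t) - Q (x rho) + (U (x t))^T *m (w t - w rho)
      + (t - rho) *: u (x t) = 0 & c (x t) = c (x rho)]) ->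
  is_derive rho (1 : R) (fun t => col_mx (x t) (w t))
    (- invmx M *m col_mx (u (x rho)) 0).
Proof.
move=> [SQ QS SQH] [Sc cS ScU] Uc uc xc Mu kkt.
(* This is the shape of the argument in the definition of the derivative at [rho] in direction
   [1]. *)
pose s (h : R) := h *: (1 : R) + rho.
have s_rho : s h @[h --> 0^'] --> rho.
  have s0 : s h @[h --> 0^'] --> (0 : R) *: (1 : R) + rho.
    exact: (cvgD (cvgZ (@nbhs_dnbhs _ (0 : R)) (cvg_cst (1 : R))) (cvg_cst rho)).
  by rewrite scale0r add0r in s0.
have xs : x (s h) @[h --> 0^'] --> x rho.
  exact: (@cvg_comp _ _ _ s x _ (nbhs rho)).
(* The left blocks are slopes between [x rho] and [x (s h)], the upper right one is [U] at the moved
   point. [A h] need not be symmetric, but its limit [M] has [U] and its transpose off the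
   diagonal. *)
pose A h := block_mx (SQ (x (s h))) (U (x (s h)))^T (Sc (x (s h))) 0.
pose q h := h^-1 *: (col_mx (x (s h)) (w (s h)) - col_mx (x rho) (w rho)).
have AM : A h @[h --> 0^'] --> M.
  apply: cvg_col_mx; apply: cvg_row_mx.
  - exact: (cvg_comp _ _ xs SQH).
  - by apply: cvg_trmx; exact: (cvg_comp _ _ xs Uc).
  - exact: (cvg_comp _ _ xs ScU).
  - exact: cvg_cst.
have Aq : A h *m q h @[h --> 0^'] --> (- col_mx (u (x rho)) 0 : 'cV[R]_(n + p)).
  have ux : - col_mx (u (x (s h))) 0 @[h --> 0^']
      --> (- col_mx (u (x rho)) 0 : 'cV[R]_(n + p)).
    apply: cvgN; apply: cvg_col_mx; last exact: cvg_cst.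
    exact: (cvg_comp _ _ xs uc).
  apply: cvg_trans ux; apply: near_eq_cvg.
  have h0 : \forall h \near 0^', h != 0 :> R by exact: nbhs_dnbhs_neq.
  apply: filterS2 h0 (s_rho _ kkt) => h h0 [Qx cx].
  rewrite /q /A -scalemxAr [- col_mx (x rho) _]opp_col_mx add_col_mx.
  rewrite mul_block_col mul0mx addr0.
  rewrite -QS -cS cx subrr scale_col_mx scaler0 opp_col_mx oppr0.
  move/eqP: Qx; rewrite addr_eq0 => /eqP ->.
  by rewrite scalerN scalerA /s addrK [_ *: 1]mulr1 mulVf// scale1r.
have qM : q h @[h --> 0^'] --> - invmx M *m col_mx (u (x rho)) 0.
  by rewrite mulNmx -mulmxN; exact: (cvg_solve AM (mulVmx Mu) Aq).
apply: DeriveDef; first by apply/cvg_ex; exists (- invmx M *m col_mx (u (x rho)) 0).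
exact: cvg_lim qM.
Qed.

(** * Continuity of the minimizer in the penalty parameter *)

Lemma norm_trmx (R : realType) (m n : nat) (A : 'M[R]_(m, n)) : `|A^T| = `|A|.
Proof.
have le (k l : nat) (B : 'M[R]_(k, l)) : `|B^T| <= `|B|.
  rewrite [leLHS]mx_normrE; apply/bigmax_leP; split=> // ij _.
  by rewrite mxE norm_coord_le.
by apply/eqP; rewrite eq_le le -[X in `|X| <= _]trmxK le.
Qed.

Lemma trmx_continuous (R : realType) (m n : nat) :
  continuous (fun A : 'M[R]_(m, n) => A^T).
Proof. by move=> A; exact: (@cvg_trmx _ (nbhs A)). Qed.

Lemma compact_sphere (R : realType) (n : nat) (c : 'cV[R]_n) (e : R) :
  compact [set v : 'rV[R]_n | `|v^T - c| = e].
Proof.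
apply: bounded_closed_compact.
  exists (e + `|c|); split; first exact: num_real.
  move=> b ltb v /= ve; apply: le_trans (ltW ltb).
  by rewrite -(norm_trmx v) -[v^T](subrK c) (le_trans (ler_normD _ _))// ve.
rewrite [X in closed X](_ : _ = (fun v : 'rV[R]_n => `|v^T - c|) @^-1` [set e]) //.
apply: closed_comp; last exact: closed_eq.
move=> v _; exact: (cvg_norm (cvgB (@trmx_continuous R 1 n v) (cvg_cst c))).
Qed.

(** If [x t] left the ball of radius [e] around [x rho], the segment joining them would cross the
    sphere at a point where the objective for [t] is below its value at [x rho]. On the sphere the
    objective for [rho] exceeds its minimum by a fixed gap, and for [t] near [rho] the increments of
    the two objectives differ by less than that gap. *)
Lemma continuous_minimizer (R : realType) (n : nat) (f P : 'cV[R]_n -> R)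
    (x : R -> 'cV[R]_n) :
  continuous f -> continuous P ->
  (forall rho, 0 < rho -> strictly_convex (fun y => f y + rho * P y)) ->
  (forall rho, 0 < rho -> minimizes (fun y => f y + rho * P y) (x rho)) ->
  forall rho, 0 < rho -> {for rho, continuous x}.
Proof.
move=> fc Pc conv xmin rho rho0.
apply/cvgrPdist_le => e e0.
pose K := [set v : 'rV[R]_n | `|v^T - x rho| = e].
(* The extreme value theorem needs a nonempty sphere. If it is empty (dimension 0), no [x t] can lie
   outside the ball, since its radial projection would be on the sphere. *)
have [K0|/set0P K0] := eqVneq K set0.
  apply: nearW => t; rewrite leNgt; apply/negP => elt.
  have : K (x rho + (e / `|x rho - x t|) *: (x t - x rho))^T.
    rewrite /K/= trmxK addrAC subrr add0r normrZ distrC normrM normfV !normr_id.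
    by rewrite divfK ?gtr0_norm// gt_eqF// distrC (lt_trans e0).
  by rewrite K0.
have tc : continuous (fun v : 'rV[R]_n => v^T) by exact: trmx_continuous.
have fT : continuous (fun v : 'rV[R]_n => f v^T).
  by move=> v; exact: (cvg_comp _ _ (tc v) (fc v^T)).
have PT : continuous (fun v : 'rV[R]_n => P v^T).
  by move=> v; exact: (cvg_comp _ _ (tc v) (Pc v^T)).
have Ec : continuous (fun v : 'rV[R]_n => f v^T + rho * P v^T).
  by move=> v; exact: (cvgD (fT v) (cvgMl_tmp (a := rho) (PT v))).
have Dc : continuous (fun v : 'rV[R]_n => `|P v^T - P (x rho)|).
  by move=> v; exact: (cvg_norm (cvgB (PT v) (cvg_cst (P (x rho))))).
have [c /set_mem Kc cmin] := compact_EVT_min K0 (@compact_sphere _ _ _ _)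
  (continuous_subspaceT Ec).
have [d /set_mem Kd dmax] := compact_EVT_max K0 (@compact_sphere _ _ _ _)
  (continuous_subspaceT Dc).
(* Moving from [y] towards a point that is no worse strictly improves the objective. It is used at
   the midpoint for [rho], to get a positive gap, and at the crossing point for [t]. *)
have conv_le t (y z : 'cV[R]_n) (a : R) : 0 < t -> y != z -> 0 < a < 1 ->
    f z + t * P z <= f y + t * P y ->
    f (a *: z + (1 - a) *: y) + t * P (a *: z + (1 - a) *: y) < f y + t * P y.
  move=> t0 yz /andP[a0 a1] zy.
  apply: lt_le_trans (conv t t0 z y a _ a0 a1) _; first by rewrite eq_sym.
  by have := ler_wpM2l (ltW a0) zy; lra.
pose gap := f c^T + rho * P c^T - (f (x rho) + rho * P (x rho)).
have gap0 : 0 < gap.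
  rewrite subr_gt0 ltNge; apply/negP => cx.
  have xc : x rho != c^T.
    apply/eqP => xc; move: Kc; rewrite /K/= xc subrr normr0 => e_eq.
    by move: e0; rewrite -e_eq ltxx.
  have := conv_le rho _ _ 2^-1 rho0 xc _ cx.
  rewrite invr_gt0 invf_lt1 ?ltr0n// ltr1n => /(_ isT).
  by rewrite ltNge xmin.
(* [B] bounds the variation of the penalty on the sphere; the added 1 makes it positive, so that
   [gap / B] is a legitimate radius. *)
pose B := `|P d^T - P (x rho)| + 1.
have B0 : 0 < B by rewrite ltr_wpDl.
near=> t.
have t0 : 0 < t by near: t; exact: lt_nbhsr.
have tB : `|t - rho| * B < gap.
  rewrite -ltr_pdivlMr// distrC; near: t.
  by apply: cvgr_dist_lt => //; rewrite divr_gt0.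
rewrite leNgt distrC; apply/negP => elt.
(* The parameter at which the segment from [x rho] to [x t] meets the sphere. *)
pose a := e / `|x t - x rho|.
have nx0 : 0 < `|x t - x rho| by rewrite (lt_trans e0).
pose v := a *: x t + (1 - a) *: x rho.
have vE : v - x rho = a *: (x t - x rho).
  rewrite /v scalerBl scale1r scalerBr -addrA; congr (_ + _).
  by rewrite addrAC subrr add0r.
have Kv : K v^T.
  rewrite /K/= trmxK vE normrZ /a normrM normfV !normr_id.
  by rewrite divfK ?gtr0_norm// gt_eqF//.
have := conv_le t (x rho) (x t) a t0 _ _ (xmin t t0 (x rho)).
rewrite -/v divr_gt0//= ltr_pdivrMr// mul1r => /(_ _ elt).
have -> : x rho != x t by rewrite -subr_eq0 -normr_gt0 distrC.
move=> /(_ isT); rewrite ltNge => /negP; apply.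
have := cmin _ (mem_set Kv); have := dmax _ (mem_set Kv).
rewrite trmxK => vd cv.
have : `|(t - rho) * (P v - P (x rho))| <= gap.
  rewrite normrM; apply: le_trans (ltW tB); rewrite ler_wpM2l//.
  by rewrite (le_trans vd)// lerDl.
rewrite ler_norml => /andP[+ _]; rewrite /gap.
lra.
Unshelve. all: by end_near. Qed.

(** * Jacobians of gradients and of affine functions *)

Section ConcreteJacobians.
Variables (R : realType) (n : nat).

Lemma has_jacobian_continuous (m : nat) (F : 'cV[R]_n -> 'cV[R]_m)
    (x : 'cV[R]_n) (J : 'M[R]_(m, n)) :
  has_jacobian F x J -> {for x, continuous F}.
Proof.
move=> [S FS SJ].
have yx0 : y - x @[y --> x] --> (0 : 'cV[R]_n).
  by rewrite -(subrr x); exact: (cvgB (@cvg_id _ (nbhs x)) (cvg_cst x)).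
have SF : F x + S y *m (y - x) @[y --> x] --> F x + J *m 0.
  exact: (cvgD (@cvg_cst _ (F x) _ (nbhs x) _) (cvg_mulmx SJ yx0)).
rewrite mulmx0 addr0 in SF; apply: cvg_trans SF.
apply: (@near_eq_cvg _ _ (nbhs x)).
by apply: (@filterE _ (nbhs x)) => y; rewrite -FS addrC subrK.
Qed.

Lemma grad_has_jacobian (f : 'cV[R]_n -> R) (x : 'cV[R]_n) :
  differentiable (dif f) x -> has_jacobian (grad f) x (hess f x).
Proof.
move=> fx; apply: has_jacobian_rows => i.
have -> : row i (hess f x) = dif (fun y => dif f y 0 i) x.
  by apply/rowP => j; rewrite !mxE.
under eq_fun do rewrite mxE.
apply: differentiable_has_jacobian.
exact: (differentiable_comp fx (differentiable_coord _ 0 i)).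
Qed.

Lemma dif_affine (a : 'rV[R]_n) (b : R) (f : 'cV[R]_n -> R) :
  (forall y, f y = (a *m y) 0 0 + b) -> dif f = fun=> a.
Proof.
move=> fE; apply/funext => x; apply/rowP => j; rewrite mxE.
apply: lim_near_cst => //=.
near=> h; have h0 : h != 0 by near: h; exact: nbhs_dnbhs_neq.
have lin : (a *m (h *: delta_mx j 0 + x)) 0 0 = h * a 0 j + (a *m x) 0 0.
  by rewrite mulmxDr mxE -scalemxAr -colE !mxE.
by rewrite /= !fE lin opprD addrACA subrr addr0 addrK [_ *: _]mulrA mulVf// mul1r.
Unshelve. all: by end_near. Qed.

Lemma affine_has_jacobian (f : 'cV[R]_n -> R) (x : 'cV[R]_n) :
  affine_function f -> has_jacobian (fun y => (f y)%:M : 'cV[R]_1) x (dif f x).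
Proof.
move=> [a [b fE]]; rewrite (dif_affine fE); exists (fun=> a) => [y|].
  rewrite !fE [RHS]mx11_scalar -raddfB; congr _%:M => /=.
  by rewrite mulmxBr !mxE opprD addrACA subrr addr0.
exact: (@cvg_cst _ _ _ (nbhs x)).
Qed.

Lemma affine_grad (f : 'cV[R]_n -> R) : affine_function f ->
  forall y z, grad f y = grad f z.
Proof. by move=> [a [b fE]] y z; rewrite /grad (dif_affine fE). Qed.

Lemma scalar_has_jacobian_continuous (f : 'cV[R]_n -> R) (x : 'cV[R]_n) J :
  has_jacobian (fun y => (f y)%:M : 'cV[R]_1) x J -> {for x, continuous f}.
Proof.
move=> /has_jacobian_continuous fc.
have fc00 : ((f y)%:M : 'cV[R]_1) 0 0 @[y --> x] --> ((f x)%:M : 'cV[R]_1) 0 0.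
  exact: (cvg_mx_coord fc).
rewrite /prop_for /continuous_at.
have -> : f = fun y => ((f y)%:M : 'cV[R]_1) 0 0; last exact: fc00.
by apply/funext => y; rewrite mxE mulr1n.
Qed.

Lemma trmx_rows_mulmx (m : nat) (v : 'I_m -> 'rV[R]_n) (w : 'cV[R]_m) :
  (\matrix_k v k)^T *m w = \sum_k w k 0 *: (v k)^T.
Proof.
apply/colP => i; rewrite mxE summxE; apply: eq_bigr => k _.
by rewrite !mxE mulrC.
Qed.

End ConcreteJacobians.

(** * Jacobians of the active constraints and of the Lagrangian gradient *)

Section Program.
Variables (R : realType) (n r s : nat) (f : 'cV[R]_n -> R).
Variables (g : 'I_r -> 'cV[R]_n -> R) (h : 'I_s -> 'cV[R]_n -> R).

Lemma surrogateE (rho : R) (y : 'cV[R]_n) :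
  surrogate f g h rho y =
  f y + rho * (\sum_i `|g i y| + \sum_j Num.max 0 (h j y)).
Proof. by rewrite /surrogate -addrA mulrDr. Qed.

Lemma active_jacobianE (x0 y : 'cV[R]_n) lam omega :
  (active_jacobian g h x0 y)^T *m col_mx lam omega =
  \sum_k lam k 0 *: grad (g (enum_val k)) y
    + \sum_k omega k 0 *: grad (h (enum_val k)) y.
Proof. by rewrite tr_col_mx mul_row_col !trmx_rows_mulmx. Qed.

Hypothesis g_affine : forall i, affine_function (g i).
Hypothesis f_diff : forall x, differentiable (dif f) x.
Hypothesis h_diff : forall j x, differentiable (h j : _ -> R^o) x.
Hypothesis h_diff2 : forall j x, differentiable (dif (h j)) x.

Lemma active_jacobian_continuous (x0 x : 'cV[R]_n) :
  {for x, continuous (active_jacobian g h x0)}.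
Proof.
apply: (@cvg_col_mx _ (nbhs x)); apply: (@cvg_mx _ (nbhs x)) => i j.
  rewrite mxE; under eq_cvg do rewrite mxE.
  have [a [b gE]] := g_affine (enum_val i); rewrite (dif_affine gE).
  exact: (@cvg_cst _ _ _ (nbhs x)).
rewrite mxE; under eq_cvg do rewrite mxE.
exact: (cvg_mx_coord (differentiable_continuous (h_diff2 _ x))).
Qed.

Lemma active_constraints_has_jacobian (x0 x : 'cV[R]_n) :
  has_jacobian
    (fun y => col_mx (\col_(k < #|eq_zero g x0|) g (enum_val k) y)
                     (\col_(k < #|ineq_zero h x0|) h (enum_val k) y))
    x (active_jacobian g h x0 x).
Proof.
apply: has_jacobian_rows => i.
have [k ->|k ->] := split_ordP i.
  rewrite rowKu rowK; under eq_fun do rewrite col_mxEu mxE.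
  exact: affine_has_jacobian.
rewrite rowKd rowK; under eq_fun do rewrite col_mxEd mxE.
exact: differentiable_has_jacobian.
Qed.

Lemma inactive_grad_has_jacobian (x0 x : 'cV[R]_n) :
  has_jacobian (inactive_grad g h x0) x (\sum_(j in ineq_pos h x0) hess (h j) x).
Proof.
rewrite -[X in has_jacobian _ _ X]add0r.
have -> : inactive_grad g h x0 = fun y =>
    (- (\sum_(i in eq_neg g x0) grad (g i) 0)
      + \sum_(i in eq_pos g x0) grad (g i) 0)
    + \sum_(j in ineq_pos h x0) grad (h j) y.
  apply/funext => y; have gE i : grad (g i) y = grad (g i) 0.
    exact: (affine_grad (g_affine i)).
  rewrite /inactive_grad (eq_bigr _ (fun i _ => gE i)).
  by rewrite [X in _ + X + _](eq_bigr _ (fun i _ => gE i)).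
apply: has_jacobianD; first exact: has_jacobian_cst.
by apply: has_jacobian_sum => j _; exact: grad_has_jacobian.
Qed.

(** With penalty and multipliers held fixed, the affine constraints have constant gradients and
    contribute nothing; what remains is the upper left block of [kkt_matrix]. *)
Lemma lagrangian_grad_has_jacobian (x0 x : 'cV[R]_n) (rho : R) lam omega :
  has_jacobian
    (fun y => grad f y + rho *: inactive_grad g h x0 y
      + (active_jacobian g h x0 y)^T *m col_mx lam omega)
    x (hess f x + rho *: (\sum_(j in ineq_pos h x0) hess (h j) x)
      + \sum_(k < #|ineq_zero h x0|) omega k 0 *: hess (h (enum_val k)) x).
Proof.
apply: has_jacobianD.
  apply: has_jacobianD; first exact: grad_has_jacobian.
  by apply: has_jacobianZ; exact: inactive_grad_has_jacobian.
rewrite -[X in has_jacobian _ _ X]add0r; under eq_fun do rewrite active_jacobianE.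
apply: has_jacobianD.
  under eq_fun do under eq_bigr do rewrite (affine_grad (g_affine _) _ 0).
  exact: has_jacobian_cst.
by apply: has_jacobian_sum => k _; apply: has_jacobianZ; exact: grad_has_jacobian.
Qed.

End Program.

(** * Stationarity and the KKT matrix near the reference point *)

Section SolutionPath.
Variables (R : realType) (n r s : nat) (f : 'cV[R]_n -> R).
Variables (g : 'I_r -> 'cV[R]_n -> R) (h : 'I_s -> 'cV[R]_n -> R).
Variable x0 : 'cV[R]_n.

(** Only strict signs are kept, so for continuous constraints the condition survives small moves;
    nothing is asked of the active constraints. *)
Definition same_inactive (y : 'cV[R]_n) : Prop :=
  [/\ forall i, g i x0 < 0 -> g i y < 0, forall i, 0 < g i x0 -> 0 < g i y,
      forall j, h j x0 < 0 -> h j y < 0 & forall j, 0 < h j x0 -> 0 < h j y].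

(** Preserved strict signs force the inactive coefficients to be -1, 0 or 1. The active ones stay
    free, so the equation holds before it is known that these constraints remain active at [y]. *)
Lemma stationarity_active (rho : R) (y : 'cV[R]_n) (sc : 'I_r -> R)
    (tc : 'I_s -> R) :
  same_inactive y -> stationary_coefs f g h rho y sc tc ->
  grad f y + rho *: inactive_grad g h x0 y
    + (active_jacobian g h x0 y)^T
        *m col_mx (eq_mult g x0 rho sc) (ineq_mult h x0 rho tc) = 0.
Proof.
move=> [gn gp hn hp] [st sg th]; rewrite active_jacobianE -[RHS]st.
have -> : \sum_i sc i *: grad (g i) y =
    - (\sum_(i in eq_neg g x0) grad (g i) y) + \sum_(i in eq_pos g x0) grad (g i) y
    + \sum_(i in eq_zero g x0) sc i *: grad (g i) y.
  rewrite (bigID (mem (eq_zero g x0))) /= addrC; congr (_ + _).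
  rewrite (bigID (mem (eq_neg g x0))) /= -sumrN; congr (_ + _).
    apply: eq_big => [i|i]; rewrite !inE.
      by case: ltgtP.
    by move=> /andP[_ gi0]; have [neg _ _] := sg i; rewrite neg ?scaleN1r// gn.
  apply: eq_big => [i|i]; rewrite !inE; first by case: ltgtP.
  move=> gi; have [_ _ pos] := sg i; rewrite pos ?scale1r//; apply: gp.
  by move: gi; case: ltgtP.
have -> : \sum_j tc j *: grad (h j) y =
    \sum_(j in ineq_pos h x0) grad (h j) y
    + \sum_(j in ineq_zero h x0) tc j *: grad (h j) y.
  rewrite (bigID (mem (ineq_zero h x0))) /= addrC; congr (_ + _).
  rewrite (bigID (mem (ineq_pos h x0))) /= [X in _ + X]big1 ?addr0 => [|j].
    apply: eq_big => [j|j]; rewrite !inE; first by case: ltgtP.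
    by move=> /andP[_ hj0]; have [_ _ pos] := th j; rewrite pos ?scale1r// hp.
  rewrite !inE => hj; have [neg _ _] := th j; rewrite neg ?scale0r//; apply: hn.
  by move: hj; case: ltgtP.
rewrite [\sum_(i in eq_zero g x0) _]big_enum_val.
rewrite [\sum_(j in ineq_zero h x0) _]big_enum_val /=.
rewrite /inactive_grad !scalerDr !scaler_sumr.
have -> : \sum_k eq_mult g x0 rho sc k 0 *: grad (g (enum_val k)) y =
    \sum_(i < #|eq_zero g x0|) rho *: (sc (enum_val i) *: grad (g (enum_val i)) y).
  by apply: eq_bigr => k _; rewrite mxE scalerA.
have -> : \sum_k ineq_mult h x0 rho tc k 0 *: grad (h (enum_val k)) y =
    \sum_(i < #|ineq_zero h x0|) rho *: (tc (enum_val i) *: grad (h (enum_val i)) y).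
  by apply: eq_bigr => k _; rewrite mxE scalerA.
rewrite -!addrA; congr (_ + (_ + (_ + _))).
by rewrite addrCA.
Qed.

Lemma near_same_inactive (T : Type) (F : set_system T) {FF : Filter F}
    (x : T -> 'cV[R]_n) :
  (forall i, {for x0, continuous (g i)}) -> (forall j, {for x0, continuous (h j)}) ->
  x @ F --> x0 -> \forall t \near F, same_inactive (x t).
Proof.
move=> gc hc xF.
have lt0 (c : 'cV[R]_n -> R) : {for x0, continuous c} ->
    \forall t \near F, c x0 < 0 -> c (x t) < 0.
  move=> cc; have [c0|_] := boolP (c x0 < 0); last exact: filterE.
  by apply: filterS (cvgr_lt (c x0) (cvg_comp _ _ xF cc) _ c0).
have gt0 (c : 'cV[R]_n -> R) : {for x0, continuous c} ->
    \forall t \near F, 0 < c x0 -> 0 < c (x t).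
  move=> cc; have [c0|_] := boolP (0 < c x0); last exact: filterE.
  by apply: filterS (cvgr_gt (c x0) (cvg_comp _ _ xF cc) _ c0).
have gn := @filter_forall _ _ _ F FF (fun i => lt0 (g i) (gc i)).
have gp := @filter_forall _ _ _ F FF (fun i => gt0 (g i) (gc i)).
have hn := @filter_forall _ _ _ F FF (fun j => lt0 (h j) (hc j)).
have hp := @filter_forall _ _ _ F FF (fun j => gt0 (h j) (hc j)).
by apply: filterS2 (filterI gn gp) (filterI hn hp) => t [? ?] [? ?].
Qed.

(** Full row rank of [U] in the form that [cvg_solve] takes: the lower right block of
    [invmx M *m M = 1] exhibits the lower left block of the inverse as [C]. *)
Lemma unit_block_linv (p : nat) (H : 'M[R]_n) (U : 'M[R]_(p, n)) :
  block_mx H U^T U 0 \in unitmx -> exists C, C *m U^T = 1%:M.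
Proof.
set M := block_mx _ _ _ _ => Mu; exists (dlsubmx (invmx M)).
have := mulVmx Mu; rewrite -{1}(submxK (invmx M)) mulmx_block.
rewrite [RHS]scalar_mx_block => /eq_block_mx[_ _ _].
by rewrite mulmx0 addr0.
Qed.

Lemma kkt_matrix_cvg (T : Type) (F : set_system T) {FF : Filter F}
    (x : T -> 'cV[R]_n) (omega : T -> 'cV[R]_#|ineq_zero h x0|) (rho : T -> R)
    (x1 : 'cV[R]_n) omega1 (rho1 : R) :
  {for x1, continuous (hess f)} ->
  (forall j, 0 <= h j x0 -> {for x1, continuous (hess (h j))}) ->
  {for x1, continuous (active_jacobian g h x0)} ->
  x @ F --> x1 -> omega @ F --> omega1 -> rho @ F --> rho1 ->
  kkt_matrix f g h x0 (x t) (omega t) (rho t) @[t --> F]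
    --> kkt_matrix f g h x0 x1 omega1 rho1.
Proof.
move=> fc hc Uc xF omegaF rhoF.
have UF : active_jacobian g h x0 (x t) @[t --> F] --> active_jacobian g h x0 x1.
  exact: (cvg_comp _ _ xF Uc).
apply: cvg_col_mx; apply: cvg_row_mx => //; last exact: cvg_cst.
  apply: cvgD; first apply: cvgD.
  - exact: (cvg_comp _ _ xF fc).
  - apply: cvgZ => //; apply: cvg_sum => j; rewrite inE => /ltW hj.
    exact: (cvg_comp _ _ xF (hc j hj)).
  - apply: cvg_sum => k _; apply: cvgZ; first exact: cvg_mx_coord.
    apply: (cvg_comp _ _ xF (hc _ _)).
    by have := enum_valP k; rewrite inE => /eqP ->.
exact: cvg_trmx.
Qed.

End SolutionPath.

(** * The differential equation along the solution path *)

Theorem proposition3p3 (R : realType) (n r s : nat)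
    (f : 'cV[R]_n -> R)
    (g : 'I_r -> 'cV[R]_n -> R) (h : 'I_s -> 'cV[R]_n -> R)
    (f_convex : convex_function [set: 'cV[R]_n] f)
    (h_convex : forall j, convex_function [set: 'cV[R]_n] (h j))
    (f_diff2 : twice_differentiable f)
    (h_diff2 : forall j, twice_differentiable (h j))
    (g_affine : forall i, affine_function (g i))
    (E_strict : forall rho : R, 0 < rho -> strictly_convex (surrogate f g h rho))
    (E_coercive : forall rho : R, 0 < rho -> coercive (surrogate f g h rho))
    (x : R -> 'cV[R]_n)
    (x_min : forall rho : R, 0 < rho -> minimizes (surrogate f g h rho) (x rho))
    (sc : R -> 'I_r -> R) (tc : R -> 'I_s -> R)
    (coefs : forall rho : R, 0 < rho ->
       stationary_coefs f g h rho (x rho) (sc rho) (tc rho))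
    (rho0 : R) (rho0_gt0 : 0 < rho0)
    (f_hess_cont : {for x rho0, continuous (hess f)})
    (h_hess_cont : forall j, 0 <= h j (x rho0) ->
       {for x rho0, continuous (hess (h j))})
    (lambda := fun rho => eq_mult g (x rho0) rho (sc rho))
    (omega := fun rho => ineq_mult h (x rho0) rho (tc rho))
    (M := kkt_matrix f g h (x rho0))
    (M_nonsing : M (x rho0) (omega rho0) rho0 \in unitmx)
    (sc_interior : forall i, g i (x rho0) = 0 -> -1 < sc rho0 i < 1)
    (tc_interior : forall j, h j (x rho0) = 0 -> 0 < tc rho0 j < 1) :
  \forall rho \near rho0,
    M (x rho) (omega rho) rho \in unitmx /\
    is_derive rho (1 : R)
      (fun rho' => col_mx (x rho') (col_mx (lambda rho') (omega rho')))
      (- invmx (M (x rho) (omega rho) rho)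
         *m col_mx (inactive_grad g h (x rho0) (x rho)) 0).
Proof.
have h_diff j y : differentiable (h j : _ -> R^o) y := (h_diff2 j).1 y.
have dh_diff j y : differentiable (dif (h j)) y := (h_diff2 j).2 y.
have g_cont i y : {for y, continuous (g i)}.
  exact: (scalar_has_jacobian_continuous (affine_has_jacobian y (g_affine i))).
have h_cont j y : {for y, continuous (h j)}.
  exact: (scalar_has_jacobian_continuous (differentiable_has_jacobian (h_diff j y))).
have f_cont : continuous f.
  move=> y; have := f_diff2.1 y => fy.
  exact: (scalar_has_jacobian_continuous (differentiable_has_jacobian fy)).
(* Collecting both penalties makes the surrogate affine in [rho], as [continuous_minimizer]
   expects. *)
pose P y := \sum_i `|g i y| + \sum_j Num.max 0 (h j y).
have P_cont : continuous P.
  move=> y; apply: (@cvgD _ _ _ (nbhs y)); apply: (@cvg_sum _ (nbhs y)) => i _.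
    exact: (cvg_norm (g_cont i y)).
  exact: (continuous_max (@cvg_cst _ (0 : R^o) _ (nbhs y) _) (h_cont i y)).
have EP rho : surrogate f g h rho = fun y => f y + rho * P y.
  by apply/funext => y; exact: surrogateE.
have x_cont rho : 0 < rho -> {for rho, continuous x}.
  by apply: (continuous_minimizer f_cont P_cont) => t /[dup] t0;
    [move/E_strict | move/x_min]; rewrite EP.
pose x0 := x rho0.
pose U := active_jacobian g h x0.
pose u := inactive_grad g h x0.
pose w rho := col_mx (lambda rho) (omega rho).
have U_cont y : {for y, continuous U} by exact: active_jacobian_continuous.
have u_cont y : {for y, continuous u}.
  exact: (has_jacobian_continuous (inactive_grad_has_jacobian g_affine dh_diff _ _)).
have gradf_cont y : {for y, continuous (grad f)}.
  exact: (has_jacobian_continuous (grad_has_jacobian (f_diff2.2 y))).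
have pos_near : \forall rho \near rho0, 0 < rho by exact: lt_nbhsr.
have xr0 : x @ rho0 --> x0 by exact: x_cont.
have st_near : \forall rho \near rho0,
    grad f (x rho) + rho *: u (x rho) + (U (x rho))^T *m w rho = 0.
  have same : \forall rho \near rho0, same_inactive g h x0 (x rho).
    exact: (@near_same_inactive _ _ _ _ _ _ _ _ (nbhs rho0)).
  apply: filterS2 pos_near same => rho rho_gt0 xrho.
  exact: stationarity_active (coefs rho rho_gt0).
have [C CU] := unit_block_linv M_nonsing.
(* Stationarity gives U^T w = - (grad f + rho u), whose right-hand side is continuous along the
   path; the left inverse [C] transfers this to [w]. *)
have w_cvg : w @ rho0 --> w rho0.
  have UwF : (U (x rho))^T *m w rho @[rho --> rho0] --> (U x0)^T *m w rho0.
    have rhs rho : grad f (x rho) + rho *: u (x rho) + (U (x rho))^T *m w rho = 0 ->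
        (U (x rho))^T *m w rho = - (grad f (x rho) + rho *: u (x rho)).
      by move/eqP; rewrite addrC addr_eq0 => /eqP.
    have -> : (U x0)^T *m w rho0 = - (grad f x0 + rho0 *: u x0).
      by apply: rhs; exact: (nbhs_singleton st_near).
    apply: (@cvg_trans _ (- (grad f (x rho) + rho *: u (x rho)) @[rho --> rho0])).
      by apply: near_eq_cvg; apply: filterS st_near => rho /rhs ->.
    have fx : grad f (x t) @[t --> rho0] --> grad f x0.
      exact: (cvg_comp _ _ xr0 (gradf_cont x0)).
    have ux : u (x t) @[t --> rho0] --> u x0.
      exact: (cvg_comp _ _ xr0 (u_cont x0)).
    exact: (cvgN (cvgD fx (cvgZ (@cvg_id _ (nbhs rho0)) ux))).
  have UF : (U (x rho))^T @[rho --> rho0] --> (U x0)^T.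
    by apply: cvg_trmx; exact: (cvg_comp _ _ xr0 (U_cont _)).
  suff : w @ rho0 --> C *m ((U x0)^T *m w rho0) by rewrite mulmxA CU mul1mx.
  exact: (cvg_solve UF CU UwF).
have lambda_cvg : lambda @ rho0 --> lambda rho0.
  apply: cvg_mx => i j; have lE t : lambda t i j = w t (lshift _ i) j.
    by rewrite col_mxEu.
  by rewrite lE; under eq_cvg do rewrite lE; exact: cvg_mx_coord.
have omega_cvg : omega @ rho0 --> omega rho0.
  apply: cvg_mx => i j; have oE t : omega t i j = w t (rshift _ i) j.
    by rewrite col_mxEd.
  by rewrite oE; under eq_cvg do rewrite oE; exact: cvg_mx_coord.
(* Were [g i (x t)] nonzero, its multiplier [t * sc t i] would equal [t] or [- t]. At [rho0] it lies
   strictly between these bounds, and it converges, so this is excluded nearby. *)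
have g_near : \forall rho \near rho0, forall i, g i x0 = 0 -> g i (x rho) = 0.
  apply: (@filter_forall _ _ _ (nbhs rho0)) => i.
  have [gi0|gi0] := eqVneq (g i x0) 0; last first.
    by apply: nearW => rho gi; rewrite gi eqxx in gi0.
  have iZ : i \in eq_zero g x0 by rewrite inE gi0.
  have sc_cvg : t * sc t i @[t --> rho0] --> rho0 * sc rho0 i.
    have lE t : t * sc t i = lambda t (enum_rank_in iZ i) 0.
      by rewrite mxE enum_rankK_in.
    by rewrite lE; under eq_cvg do rewrite lE; exact: cvg_mx_coord.
  have /andP[sc_lo sc_hi] := sc_interior i gi0.
  have hi : \forall t \near rho0, t * sc t i - t < 0.
    apply: (cvgr_lt _ (cvgB sc_cvg (@cvg_id _ (nbhs rho0)))).
    by rewrite subr_lt0 gtr_pMr.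
  have lo : \forall t \near rho0, 0 < t * sc t i + t.
    apply: (cvgr_gt _ (cvgD sc_cvg (@cvg_id _ (nbhs rho0)))).
    by rewrite -{3}[rho0]mulr1 -mulrDr mulr_gt0// -ltrBlDr sub0r.
  near=> t => _; have t0 : 0 < t by near: t.
  have [_ /(_ i) [neg _ pos] _] := coefs t t0.
  have [/neg sE|/pos sE|//] := ltgtP (g i (x t)) 0.
    suff : 0 < t * sc t i + t by rewrite sE mulrN1 addNr ltxx.
    by near: t.
  suff : t * sc t i - t < 0 by rewrite sE mulr1 subrr ltxx.
  by near: t.
(* The same argument with the multiplier strictly between 0 and [t]. *)
have h_near : \forall rho \near rho0, forall j, h j x0 = 0 -> h j (x rho) = 0.
  apply: (@filter_forall _ _ _ (nbhs rho0)) => j.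
  have [hj0|hj0] := eqVneq (h j x0) 0; last first.
    by apply: nearW => rho hj; rewrite hj eqxx in hj0.
  have jZ : j \in ineq_zero h x0 by rewrite inE hj0.
  have tc_cvg : t * tc t j @[t --> rho0] --> rho0 * tc rho0 j.
    have oE t : t * tc t j = omega t (enum_rank_in jZ j) 0.
      by rewrite mxE enum_rankK_in.
    by rewrite oE; under eq_cvg do rewrite oE; exact: cvg_mx_coord.
  have /andP[tc_lo tc_hi] := tc_interior j hj0.
  have hi : \forall t \near rho0, t * tc t j - t < 0.
    apply: (cvgr_lt _ (cvgB tc_cvg (@cvg_id _ (nbhs rho0)))).
    by rewrite subr_lt0 gtr_pMr.
  have lo : \forall t \near rho0, 0 < t * tc t j.
    by apply: (cvgr_gt _ tc_cvg); rewrite mulr_gt0.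
  near=> t => _; have t0 : 0 < t by near: t.
  have [_ _ /(_ j) [neg _ pos]] := coefs t t0.
  have [/neg sE|/pos sE|//] := ltgtP (h j (x t)) 0.
    suff : 0 < t * tc t j by rewrite sE mulr0 ltxx.
    by near: t.
  suff : t * tc t j - t < 0 by rewrite sE mulr1 subrr ltxx.
  by near: t.
have M_near : \forall rho \near rho0, M (x rho) (omega rho) rho \in unitmx.
  apply: (@near_unitmx R (nbhs rho0) _ _ _ _ _ _ M_nonsing).
  exact: (kkt_matrix_cvg f_hess_cont h_hess_cont (U_cont _) xr0 omega_cvg
    (@cvg_id _ (nbhs rho0))).
(* The derivative at a nearby [rho] compares it with points [t] around [rho], so each property must
   hold on a whole neighbourhood of every such [rho]. *)
have := near_join st_near; have := near_join g_near; have := near_join h_near.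
move=> h_near2 g_near2 st_near2.
near=> rho.
have Mu : M (x rho) (omega rho) rho \in unitmx by near: rho.
split=> //.
have rho_gt0 : 0 < rho by near: rho.
pose Q y := grad f y + rho *: u y + (U y)^T *m w rho.
pose c y := col_mx (\col_(k < #|eq_zero g x0|) g (enum_val k) y)
                   (\col_(k < #|ineq_zero h x0|) h (enum_val k) y).
apply: (@kkt_path_is_derive _ _ _ Q u c U) => //.
- exact: (lagrangian_grad_has_jacobian g_affine f_diff2.2 dh_diff).
- exact: active_constraints_has_jacobian.
- exact: x_cont.
have st_rho : \forall t \near rho,
    grad f (x t) + t *: u (x t) + (U (x t))^T *m w t = 0.
  by near: rho.
have g_rho : \forall t \near rho, forall i, g i x0 = 0 -> g i (x t) = 0.
  by near: rho.
have h_rho : \forall t \near rho, forall j, h j x0 = 0 -> h j (x t) = 0.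
  by near: rho.
have cx0 t : (forall i, g i x0 = 0 -> g i (x t) = 0) ->
    (forall j, h j x0 = 0 -> h j (x t) = 0) -> c (x t) = 0.
  move=> gt ht; rewrite /c -[RHS]col_mx0; congr col_mx; apply/colP => k;
    rewrite !mxE; [apply: gt | apply: ht];
    by have := enum_valP k; rewrite inE => /eqP.
near=> t; have gt : forall i, g i x0 = 0 -> g i (x t) = 0 by near: t.
have ht : forall j, h j x0 = 0 -> h j (x t) = 0 by near: t.
split; last first.
  rewrite !cx0 //; first exact: (nbhs_singleton g_rho).
  exact: (nbhs_singleton h_rho).
have st_t : grad f (x t) + t *: u (x t) + (U (x t))^T *m w t = 0 by near: t.
(* Unfreezing: adding the increments of multipliers and penalty to [Q (x t)] restores the
   stationarity equation at [t], while [Q (x rho)] vanishes by stationarity at [rho]. *)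
have cancel (a b d k e : 'cV[R]_n) : a + b + d + (k - d) + (e - b) = a + e + k.
  rewrite (addrC k) [X in X + _]addrA addrK (addrC e) addrA (addrAC _ k).
  by rewrite addrK addrAC.
rewrite [X in _ - X](nbhs_singleton st_rho) subr0 -[RHS]st_t /Q mulmxBr scalerBl.
exact: cancel.
Unshelve. all: by end_near. Qed.
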